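(* Define sets of positive integers $R_1,R_2,\dots$ by $R_1=\{2\}$ and $R_{k+1}=\{(x+5)^2 : x\in R_k\}\cup\{x\in\mathbb{Z}_{>0}: x^2\in R_k\}$ for $k\geq 1$. Let $V=\{n\in\mathbb{Z}: n\geq 2,\ 5\nmid n\}$ and let $\Gamma_5$ be the directed graph on $V$ with up-edges $(n,(n+5)^2)$ and down-edges $(n^2,n)$ for $n\in V$. Let $a$ be a positive integer with $a<100$ such that $a\in R_i$ for some $i\leq 150$. Then there exists a directed path in $\Gamma_5$ from $2$ to $a$ all of whose vertices are at most $188^4$.
   Context: A directed path from $x$ to $y$ is a finite sequence of vertices $x=v_0,\dots,v_m=y$ with each $(v_{j-1},v_j)$ an edge of $\Gamma_5$. *)

(* Defs.v *)
From mathcomp Require Import all_boot.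
Set Implicit Arguments. Unset Strict Implicit. Unset Printing Implicit Defensive.

(* Rset k x  <->  x \in R_k.  Indexing as in the paper: R_1 = {2};
   R_0 is unused and taken empty. *)
Fixpoint Rset (k : nat) : nat -> Prop :=
  match k with
  | 0 => fun _ => False
  | 1 => fun x => x = 2
  | k'.+1 => fun y =>
      (exists x, Rset k' x /\ y = (x + 5) ^ 2) \/ (0 < y /\ Rset k' (y ^ 2))
  end.

Definition inV (n : nat) : bool := (2 <= n) && ~~ (5 %| n).

Definition gamma5_edge : rel nat :=
  fun u v => (inV u && (v == (u + 5) ^ 2)) || (inV v && (u == v ^ 2)).

(* Main.v *)
Require Import Defs.
From mathcomp Require Import all_boot.
From mathcomp Require Import zify.

Set Implicit Arguments.
Unset Strict Implicit.

(** Read a walk from 2 as a word in U : n |-> (n+5)^2 and D : n^2 |-> n, and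
match its letters like parentheses. A balanced word with m letters U, leading
from x to y, satisfies x <= y <= x + 5m. So if U w D leads from x to z with w
balanced, then either z = x+5 and w may be deleted, or passing from the square
(x+5)^2 to a later square costs about 2(x+5)/5 letters U, which with fewer
than 150 letters in total forces z <= 188. After these deletions a balanced
word ending at y stays below max(y^2, 188^4). The unmatched letters D only
decrease small values, and the values from which the unmatched letters U start
are at most the endpoint a < 100. *)

Definition conn (N x y : nat) : Prop :=
  exists p : seq nat, path gamma5_edge x p /\ last x p = y /\
    all (fun v => v <= N) (x :: p).

Lemma conn_refl N x : x <= N -> conn N x x.
Proof. by move=> xN; exists [::]; rewrite /= xN. Qed.

Lemma conn_trans N x y z : conn N x y -> conn N y z -> conn N x z.
Proof.
move=> [p [pp [<- ap]]] [q [pq [<- aq]]]; exists (p ++ q).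
rewrite cat_path pp pq last_cat -cat_cons all_cat ap; split=> //; split=> //.
by case/andP: aq.
Qed.

Lemma conn_le M N x y : M <= N -> conn M x y -> conn N x y.
Proof.
move=> MN [p [pp [lp ap]]]; exists p; split=> //; split=> //.
by apply: sub_all ap => v vM; exact: leq_trans MN.
Qed.

Lemma conn_edge N x y : gamma5_edge x y -> x <= N -> y <= N -> conn N x y.
Proof. by move=> e xN yN; exists [:: y]; rewrite /= e xN yN. Qed.

Lemma conn_up N x : inV x -> (x + 5) ^ 2 <= N -> conn N x ((x + 5) ^ 2).
Proof.
move=> Vx le_N; apply: conn_edge => //; first by rewrite /gamma5_edge Vx eqxx.
by apply: leq_trans le_N; nia.
Qed.

Lemma conn_down N z : inV z -> z ^ 2 <= N -> conn N (z ^ 2) z.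
Proof.
move=> Vz le_N; apply: conn_edge => //.
  by rewrite /gamma5_edge Vz eqxx orbT.
by apply: leq_trans le_N; nia.
Qed.

Lemma inV_sqr z : inV (z ^ 2) -> inV z.
Proof. by rewrite /inV Euclid_dvdX // andbT; case: z => [|[]]. Qed.

Lemma inV_up x : inV x -> inV ((x + 5) ^ 2).
Proof.
rewrite /inV Euclid_dvdX // andbT dvdn_addl // => /andP[x2 ->].
by rewrite andbT; nia.
Qed.

(* What is retained of a balanced word with m letters U leading from x to y. *)
Definition rise (m x y : nat) : Prop :=
  [/\ inV y, x <= y, y <= x + 5 * m &
      m <= 74 -> conn (maxn (y ^ 2) (188 ^ 4)) x y].

Lemma rise_refl x : inV x -> rise 0 x x.
Proof.
move=> Vx; split=> //; first by rewrite muln0 addn0.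
by move=> _; apply: conn_refl; rewrite leq_max; apply/orP; left; nia.
Qed.

Lemma rise_trans m n x y z : rise m x y -> rise n y z -> rise (m + n) x z.
Proof.
move=> [_ xy yx cxy] [Vz yz zy cyz]; split=> //; [lia | lia | move=> mn].
apply: (@conn_trans _ _ y); last by apply: cyz; lia.
apply: conn_le (cxy _); last by lia.
by rewrite geq_max !leq_max leq_exp2r // yz leqnn orbT.
Qed.

Lemma rise_hump n x z :
  inV x -> rise n ((x + 5) ^ 2) (z ^ 2) -> rise n.+1 x z.
Proof.
move=> Vx [/inV_sqr Vz lo hi c].
have xz : x + 5 <= z by rewrite -(leq_exp2r _ _ (isT : 0 < 2)).
split=> //; [lia | nia | move=> n74].
have zN : z ^ 2 <= maxn (z ^ 2) (188 ^ 4) by rewrite leq_max leqnn.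
apply: (@conn_trans _ _ ((x + 5) ^ 2)).
  by apply: conn_up => //; apply: leq_trans zN.
apply: (@conn_trans _ _ (z ^ 2)); last exact: conn_down.
have [->|ne_z] := eqVneq z (x + 5); first by apply: conn_refl; rewrite leq_maxl.
have z188 : z <= 188 by nia.
apply: conn_le (c _); last by lia.
by rewrite geq_max leq_maxr andbT -expnM leq_max leq_exp2r // z188 orbT.
Qed.

(* What is retained of a word of length k without unmatched letter U leading
from 2 to x. *)
Definition low (k x : nat) : Prop :=
  [/\ inV x, 2 * x <= 4 + 5 * k & k <= 149 -> conn (188 ^ 4) 2 x].

Lemma low_start : low 0 2.
Proof. by split=> // _; apply: conn_refl; lia. Qed.

Lemma sqr_le_bound y : y <= 1000 -> y ^ 2 <= 188 ^ 4.
Proof. nia. Qed.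

Lemma low_rise k m x y : low k x -> rise m x y -> low (k + m.*2) y.
Proof.
move=> [Vx xk cx] [Vy xy yx cy]; split=> //; [lia | move=> km].
apply: conn_trans (cx _) _; first by lia.
apply: conn_le (cy _); last by lia.
by rewrite geq_max leqnn andbT; apply: sqr_le_bound; lia.
Qed.

Lemma low_down k y : low k (y ^ 2) -> low k.+1 y.
Proof.
move=> [/inV_sqr Vy yk cy]; split=> //; [nia | move=> k149].
apply: conn_trans (cy _) _; first by lia.
by apply: conn_down => //; apply: sqr_le_bound; lia.
Qed.

(* Each use of [high_up] accounts for one unmatched letter U and the balanced
word after it. *)
Inductive high : nat -> nat -> Prop :=
| high_low k y : low k y -> high k y
| high_up k x m y :
    high k x -> rise m ((x + 5) ^ 2) y -> high (k.+1 + m.*2) y.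

Lemma high_inV k y : high k y -> inV y.
Proof. by case=> [? ? []|? ? ? ? _ []]. Qed.

Lemma high_rise k m x y : high k x -> rise m x y -> high (k + m.*2) y.
Proof.
case=> {k x} [k x lx | k x n z hx rz] r; first exact: high_low (low_rise lx r).
by rewrite -addnA -doubleD; apply: high_up hx _; exact: rise_trans r.
Qed.

Lemma high_down k y : high k (y ^ 2) -> high k.+1 y.
Proof.
move ew: (y ^ 2) => w h.
case: h ew => [j z lz | j x m z hx r] ez; subst z.
  exact: high_low (low_down lz).
rewrite (_ : (j.+1 + m.*2).+1 = j + m.+1.*2); last by lia.
exact: high_rise hx (rise_hump (high_inV hx) r).
Qed.

Lemma Rset_high k x : Rset k.+1 x -> high k x.
Proof.
elim: k x => [|k IH] x; first by move=> /= ->; apply: high_low low_start.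
case=> [[y [/IH hy ->]] | [_ /IH]]; last exact: high_down.
rewrite -[k.+1]addn0; apply: (@high_up _ _ 0 _ hy).
exact: rise_refl (inV_up (high_inV hy)).
Qed.

Lemma high_conn k y : high k y -> k <= 149 -> y < 100 -> conn (188 ^ 4) 2 y.
Proof.
elim=> {k y} [k y [_ _ c] k149 _ | k x m y hx IH [Vy xy _ c] km y100].
  exact: c.
apply: conn_trans (IH _ _) _; [by lia | by nia |].
apply: conn_trans (conn_up (high_inV hx) _) _.
  by apply: sqr_le_bound; lia.
apply: conn_le (c _); last by lia.
by rewrite geq_max leqnn andbT; apply: sqr_le_bound; lia.
Qed.

Unset Implicit Arguments.
Set Strict Implicit.

Theorem theorem14 (a : nat) :
  0 < a -> a < 100 -> (exists i, 1 <= i <= 150 /\ Rset i a) ->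
  exists p : seq nat,
    path gamma5_edge 2 p /\ last 2 p = a /\ all (fun v => v <= 188 ^ 4) (2 :: p).
Proof.
move=> _ a100 [[|i] [// le_i /Rset_high ha]].
exact: high_conn ha le_i a100.
Qed.
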